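(* For every integer $r\ge2$ and every real $2\le p<\infty$ there is a constant $C_{r,p}>0$, depending only on $r$ and $p$, such that the following holds for every integer $d\ge1$. Let $T\in(\mathbb{R}^d)^{\otimes r}$ be a random symmetric Gaussian tensor with $\mathbb{E}[T]=0$ such that the entries $T_{i_1,\dots,i_r}$ with $i_1\le i_2\le\cdots\le i_r$ are independent (with possibly different variances). Let $A\in(\mathbb{R}^d)^{\otimes r}$ be the variance tensor $A_{i_1,\dots,i_r}=\mathbb{E}[T_{i_1,\dots,i_r}^2]$ and let $\mathbf{1}\in\mathbb{R}^d$ be the all-ones vector. Then $$ d^{\frac1p-\frac12}\,\mathbb{E}\|T\|_{\mathcal{I}_p}\le C_{r,p}\Big((\log d)\,\|A\mathbf{1}\|_{\mathcal{I}_{p/2}}^{\frac12}+\max_{2\le q\le r}\|A\mathbf{1}^{\otimes q}\|_{\mathcal{I}_{p/2}}^{\frac1{2q}}\,\|A\|_{\mathcal{I}_{p/2}}^{\frac{q-1}{2q}}\Big).$$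
   Context: A tensor is symmetric if its entries are invariant under all permutations of the indices. For a real $s\ge1$ and a tensor $S\in(\mathbb{R}^d)^{\otimes m}$, $m\ge1$, the $\ell_s$ injective norm is $\|S\|_{\mathcal{I}_s}=\sup\{\langle S,x_1\otimes\cdots\otimes x_m\rangle : \|x_1\|_s,\dots,\|x_m\|_s\le1\}$, with $\langle\cdot,\cdot\rangle$ the entrywise inner product; for an order $0$ tensor (scalar) it is the absolute value. For $0\le q\le r$, $A\mathbf{1}^{\otimes q}$ is the order $r-q$ tensor obtained by contracting $q$ indices of the symmetric tensor $A$ with $\mathbf{1}$, i.e. $(A\mathbf{1}^{\otimes q})_{i_1,\dots,i_{r-q}}=\sum_{k_1,\dots,k_q=1}^dA_{i_1,\dots,i_{r-q},k_1,\dots,k_q}$; $A\mathbf{1}=A\mathbf{1}^{\otimes1}$. *)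

(* Defs.v *)
From HB Require Import structures.
From mathcomp Require Export all_boot all_order all_algebra all_fingroup.
From mathcomp Require Export all_classical all_reals all_analysis.

Set Implicit Arguments.
Unset Strict Implicit.
Unset Printing Implicit Defensive.

Import Order.TTheory GRing.Theory Num.Theory.
Import numFieldNormedType.Exports.

Local Open Scope classical_set_scope.
Local Open Scope ring_scope.

Section Tensors.
Variables (R : realType) (d : nat).

Definition tensor (m : nat) : Type := {ffun m.-tuple 'I_d -> R}.

Definition lnorm (s : R) (x : 'rV[R]_d) : R :=
  (\sum_(j < d) `|x 0 j| `^ s) `^ s^-1.

(* <S, x_0 (x) ... (x) x_(m-1)> *)
Definition rank1_pairing (m : nat) (S : tensor m) (x : 'I_m -> 'rV[R]_d) : R :=
  \sum_(i : m.-tuple 'I_d) S i * \prod_(k < m) x k 0 (tnth i k).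

Definition injnorm (s : R) (m : nat) : tensor m -> R :=
  match m with
  | 0 => fun S => `|S [tuple]|
  | m'.+1 => fun S => sup [set rank1_pairing S x | x in
                           [set x : 'I_m'.+1 -> 'rV[R]_d |
                             forall k, lnorm s (x k) <= 1]]
  end.

(* A 1^{(x) q}: the last q indices are summed out; [tcast] only identifies
   tuples of size (r - q) + q with tuples of size r. *)
Definition contract1 (r q : nat) (hq : (q <= r)%N) (A : tensor r) :
    tensor (r - q) :=
  [ffun i : (r - q).-tuple 'I_d =>
    \sum_(k : q.-tuple 'I_d) A (tcast (subnK hq) [tuple of i ++ k])].

Definition symmetric_tensor (r : nat) (S : tensor r) : Prop :=
  forall (s : {perm 'I_r}) (i : r.-tuple 'I_d),
    S [tuple tnth i (s k) | k < r] = S i.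

Definition nondecreasing_index (r : nat) (i : r.-tuple 'I_d) : bool :=
  [forall k : 'I_r, forall l : 'I_r,
    (k <= l)%N ==> (tnth i k <= tnth i l)%N].

End Tensors.

Section Randomness.
Context {disp : measure_display} {Omega : measurableType disp} {R : realType}
  (P : probability Omega R).

(* N(mu, sigma^2), where sigma = 0 is the point mass at mu. This case is apart
   because the library's [normal_prob mu 0] is a uniform distribution. *)
Definition gaussian_rv (X : Omega -> R) : Prop :=
  exists mu sigma : R, forall B : set R, measurable B ->
    pushforward P X B = if sigma == 0 then \d_mu B else normal_prob mu sigma B.

Definition jointly_gaussian (I : finType) (X : I -> {RV P >-> R}) : Prop :=
  forall c : I -> R, gaussian_rv (fun w => \sum_(i : I) c i * X i w).

Definition mutually_independent (I : finType) (D : pred I)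
    (X : I -> {RV P >-> R}) : Prop :=
  forall J : {set I}, J \subset D ->
  forall B : I -> set R, (forall i, measurable (B i)) ->
    P (\bigcap_(i in [set i | i \in J]) (X i @^-1` B i)) =
    (\prod_(i in J) P (X i @^-1` B i))%E.

Section RandomTensors.
Variables (d r : nat) (T : r.-tuple 'I_d -> {RV P >-> R}).

Definition realization (w : Omega) : tensor R d r := [ffun i => T i w].

(* [fine] is harmless on Gaussian entries: they have finite second moments. *)
Definition variance_tensor : tensor R d r :=
  [ffun i => fine 'E_P[fun w => (T i w ^+ 2)%R]%E].

End RandomTensors.
End Randomness.

(* Main.v *)
Require Import Defs.
From HB Require Import structures.
From mathcomp Require Import measurable_realfun ring lra.

(** The supremum over the l_p balls is bounded by a PAC-Bayes argument at a
    single scale. Round each vector [x_k] independently to a random grid point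
    [y_k] with mean [x_k] and coordinatewise variance at most [t^2]. By
    multilinearity <T, x_1 (x) ... (x) x_r> is the mean of
    <T, y_1 (x) ... (x) y_r>, and the law of [(y_k)] has relative entropy at
    most [r D / t^2] with respect to the law for [x = 0], where [D] is the
    largest squared Euclidean norm [d^(1-2/p)] on the unit ball. The variational
    inequality for the entropy, applied to the exponential
    exp(l <T, y> - l^2 Var<T, y> / 2) whose expectation is at most 1 for each
    fixed [y], gives for all [l > 0]
      E ||T|| <= r D / (t^2 l) + (l / 2) r! sup_x E Var'(y),
    where Var'(y) = sum_i A_i prod_k y_k(i_k)^2. Taking the mean over the
    rounding and expanding the products yields
    E Var'(y) <= sum_q C(r,q) t^(2q) ||A 1^q||. The choice of [t] balancing
    [q = 0] against all [q >= 2] gives the maximum in the statement, and [q = 1]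
    contributes ||A 1||^(1/2) without the logarithm. *)

Set Implicit Arguments.
Unset Strict Implicit.
Unset Printing Implicit Defensive.

Import Order.TTheory GRing.Theory Num.Theory.
Import numFieldNormedType.Exports.
Local Open Scope classical_set_scope.
Local Open Scope ring_scope.

(** * Gaussian variables *)

(** [normal_pdf] is almost everywhere the Radon-Nikodym derivative of [normal_prob], since both have
    the same integral over every measurable set. *)
Lemma ge0_integral_normal_prob (R : realType) (m s : R) (f : R -> \bar R) :
  measurable_fun setT f -> (forall x, (0 <= f x)%E) ->
  (\int[normal_prob m s]_x f x
   = \int[lebesgue_measure]_x (f x * (normal_pdf m s x)%:E))%E.
Proof.
move=> mf f0; have dom := normal_prob_dominates m s.
rewrite -(Radon_Nikodym_SigmaFinite.change_of_variables dom)//.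
have iRN := Radon_Nikodym_SigmaFinite.f_integrable dom.
have mpdf : measurable_fun setT (EFin \o normal_pdf m s).
  by apply/measurable_EFinP; exact: measurable_normal_pdf.
apply: ae_eq_integral => //.
- apply: emeasurable_funM => //; exact: measurable_int iRN.
- exact: emeasurable_funM.
apply: ae_eqe_mul2l; apply: integral_ae_eq => //.
by move=> E _ mE; rewrite -Radon_Nikodym_SigmaFinite.f_integral.
Qed.

(** Completing the square: exp(l x) times the density of N(m, s^2) is a constant multiple of the
    density of N(m + l s^2, s^2), which has integral 1. *)
Lemma normal_prob_mgf (R : realType) (m s l : R) : s != 0 ->
  (\int[normal_prob m s]_x (expR (l * x))%:E
   = (expR (l * m + l ^+ 2 * s ^+ 2 / 2))%:E)%E.
Proof.
move=> s0.
rewrite ge0_integral_normal_prob; last 2 first.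
- by apply/measurable_EFinP; apply: measurableT_comp => //; exact: measurable_funM.
- by move=> x; rewrite lee_fin expR_ge0.
transitivity (\int[lebesgue_measure]_x
    ((expR (l * m + l ^+ 2 * s ^+ 2 / 2))%:E
      * (normal_pdf (m + l * s ^+ 2) s x)%:E)%E)%E.
  apply: eq_integral => x _; rewrite -!EFinM; congr EFin.
  rewrite !normal_pdfE// /normal_fun mulrCA [RHS]mulrCA.
  rewrite -!expRD; congr (_ * expR _).
  by field.
rewrite ge0_integralZl_EFin//=; last 2 first.
- by move=> x _; rewrite lee_fin normal_pdf_ge0.
- by apply/measurable_EFinP; exact: measurable_normal_pdf.
by rewrite integral_normal_pdf mule1.
Qed.

(** One formula covers point masses (s = 0) and nondegenerate laws. Here m and s come from the law
    and are not yet related to the moments of [X]. *)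
Lemma gaussian_mgf disp (Omega : measurableType disp) (R : realType)
    (P : probability Omega R) (X : {RV P >-> R}) :
  gaussian_rv P X -> exists m s : R, forall l,
    (\int[P]_w (expR (l * X w))%:E
     = (expR (l * m + l ^+ 2 * s ^+ 2 / 2))%:E)%E.
Proof.
move=> [m [s H]]; exists m, s => l.
(* [normal_prob] is a measure on [measurableTypeR R], whose display differs from
   that of [R]; [X] is repackaged with values in this type. *)
have mX : measurable_fun setT (X : Omega -> measurableTypeR R).
  exact: (measurable_funPT X).
pose Y : {mfun Omega >-> measurableTypeR R} :=
  HB.pack (X : Omega -> measurableTypeR R) (isMeasurableFun.Build _ _ _ _ _ mX).
have mexp : measurable_fun [set: measurableTypeR R] (fun x => (expR (l * x))%:E).
  by apply/measurable_EFinP; apply: measurableT_comp => //; exact: measurable_funM.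
transitivity (\int[pushforward P Y]_x (expR (l * x))%:E)%E.
  by rewrite ge0_integral_pushforward// preimage_setT.
have [s0|s0] := eqVneq s 0.
  transitivity (\int[\d_(m : measurableTypeR R)]_x (expR (l * x))%:E)%E.
    apply: eq_measure_integral => A mA _.
    by have := H A mA; rewrite s0 eqxx.
  rewrite integral_dirac// diracT mul1e s0.
  by congr (expR _)%:E; field.
rewrite -normal_prob_mgf//; apply: eq_measure_integral => A mA _.
by have := H A mA; rewrite (negbTE s0).
Qed.

(** The exponential series from degree 3 on is dominated term by term by |u|^3 times the series at
    |u|, because (n + 3)! >= n!. *)
Lemma expR_le_taylor2 (R : realType) (u : R) :
  expR u <= 1 + u + u ^+ 2 / 2 + `|u| ^+ 3 * expR `|u|.
Proof.
rewrite [leLHS]/expR; apply: limr_le; first exact: is_cvg_series_exp_coeff.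
near=> k; have k3 : (3 <= k)%N by near: k; exact: nbhs_infty_ge.
rewrite -(subnK k3); move: (k - 3)%N => n.
rewrite /series/= addnC (@big_cat_nat _ _ _ 3)//= ?leq_addr//.
rewrite 3?big_nat_recl// big_geq// addr0 /exp_coeff/= expr0 expr1.
rewrite fact0 factS fact0 !factS fact0 !divr1.
apply: lerD; first by rewrite addrA.
apply: (@le_trans _ _ (`|u| ^+ 3 * series (exp_coeff `|u|) n)).
  rewrite /series/= mulr_sumr -{1}(add0n 3%N) (addnC 3%N n) big_addn addnK.
  apply: ler_sum => i _; rewrite /exp_coeff/=.
  apply: (@le_trans _ _ (`|u ^+ (i + 3) / (i + 3)`!%:R|)); first exact: ler_norm.
  rewrite normrM normrX normfV (ger0_norm (ler0n _ _)) addnC exprD -mulrA.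
  rewrite ler_wpM2l ?exprn_ge0// ler_wpM2l ?exprn_ge0//.
  by rewrite lef_pV2 ?posrE ?ltr0n ?fact_gt0// ler_nat leq_fact// leq_addl.
apply: ler_wpM2l; first exact: exprn_ge0.
apply: nondecreasing_cvgn_le; last exact: is_cvg_series_exp_coeff.
apply: nondecreasing_series => i _ _; exact: exp_coeff_ge0.
Unshelve. all: by end_near. Qed.

(** A second-order expansion in l whose remainder is |l|^3 times a function of x independent of l,
    integrable for Gaussian x. It uses |x|^3 <= 6 exp |x|. *)
Lemma expR_scaled_le (R : realType) (l x : R) : `|l| <= 1 ->
  expR (l * x) <= 1 + l * x + l ^+ 2 / 2 * x ^+ 2
                  + `|l| ^+ 3 * 6 * (expR (2 * x) + expR (- 2 * x)).
Proof.
move=> l1; apply: (le_trans (expR_le_taylor2 _)).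
rewrite exprMn mulrAC lerD2l normrM exprMn -2!mulrA ler_wpM2l ?exprn_ge0//.
have h3 : `|x| ^+ 3 <= 6 * expR `|x|.
  have := expR_ge1Dxn 2 (normr_ge0 x); rewrite !factS fact0 !muln1.
  have := exprn_ge0 3 (normr_ge0 x); lra.
have h1 : expR (`|l| * `|x|) <= expR `|x| by rewrite ler_expR ler_piMl.
have h2 : expR `|x| * expR `|x| <= expR (2 * x) + expR (- 2 * x).
  rewrite -expRD; case: (ger0P x) => _.
    by rewrite (_ : x + x = 2 * x) ?lerDl ?expR_ge0//; ring.
  by rewrite (_ : - x - x = - 2 * x) ?lerDr ?expR_ge0//; ring.
have e0 := expR_ge0 `|x|.
apply: (le_trans (ler_pM _ _ h3 h1)); rewrite ?exprn_ge0 ?expR_ge0//.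
by rewrite -mulrA ler_wpM2l.
Qed.

Lemma integrable_le_fin d (T : measurableType d) (R : realType)
    (mu : {measure set T -> \bar R}) (f g : T -> R) :
  measurable_fun setT f -> (forall w, `|f w| <= g w) ->
  mu.-integrable setT (EFin \o g) -> mu.-integrable setT (EFin \o f).
Proof.
move=> mf fg; apply: le_integrable => //; first exact/measurable_EFinP.
by move=> w _; rewrite lee_fin (le_trans (fg w))// ler_norm.
Qed.

Lemma integrable_EFinD d (T : measurableType d) (R : realType)
    (mu : {measure set T -> \bar R}) (f g : T -> R) :
  mu.-integrable setT (EFin \o f) -> mu.-integrable setT (EFin \o g) ->
  mu.-integrable setT (EFin \o (fun w => f w + g w)).
Proof. by move=> fi gi; have := integrableD measurableT fi gi. Qed.

Lemma integrable_EFinZl d (T : measurableType d) (R : realType)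
    (mu : {measure set T -> \bar R}) (k : R) (f : T -> R) :
  mu.-integrable setT (EFin \o f) ->
  mu.-integrable setT (EFin \o (fun w => k * f w)).
Proof. by move=> fi; have := integrableZl measurableT k fi. Qed.

Section GaussianVariable.
Context disp (Omega : measurableType disp) (R : realType)
  (P : probability Omega R) (X : {RV P >-> R}) (gX : gaussian_rv P X).

Lemma gaussian_integrable_expR (l : R) :
  P.-integrable setT (EFin \o (fun w => expR (l * X w))).
Proof.
apply/integrableP; split.
  apply/measurable_EFinP; apply: measurableT_comp => //.
  exact: measurable_funM.
have [m [s /(_ l) E]] := gaussian_mgf gX.
under eq_integral do rewrite /= ger0_norm ?expR_ge0//.
by rewrite E ltry.
Qed.

Let integrable_expR2 : P.-integrable setT
  (EFin \o (fun w => expR (1 * X w) + expR (- 1 * X w))).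
Proof. by apply: integrable_EFinD; exact: gaussian_integrable_expR. Qed.

(** Two integrable exponentials dominate both |x| and x^2, so the first two moments exist. *)
Let le_expR2 (x : R) : 1 + `|x| + x ^+ 2 / 2 <= 2 * (expR (1 * x) + expR (- 1 * x)).
Proof.
have e0 (y : R) := expR_ge0 y.
have h (y : R) : 0 <= y -> 1 + y + y ^+ 2 / 2 <= 2 * expR y.
  move=> y0; have := expR_ge1Dxn 1 y0; have := expR_ge1Dx y.
  rewrite !factS fact0 !muln1; have := sqr_ge0 y; lra.
case: (ger0P x) => x0.
  by have := h _ x0; rewrite mul1r; have := e0 (- 1 * x); lra.
have := h (- x); rewrite sqrrN mul1r mulN1r => /(_ (ltW _)).
by rewrite oppr_gt0 => /(_ x0); have := e0 x; lra.
Qed.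

Lemma gaussian_integrable : P.-integrable setT (EFin \o X).
Proof.
apply: (@integrable_le_fin _ _ _ _ _
   (fun w => 2 * (expR (1 * X w) + expR (- 1 * X w)))) => //.
  by move=> w; have := le_expR2 (X w); have := sqr_ge0 (X w); lra.
exact: integrable_EFinZl.
Qed.

Lemma gaussian_integrable_sqr : P.-integrable setT (EFin \o (fun w => X w ^+ 2)).
Proof.
apply: (@integrable_le_fin _ _ _ _ _
   (fun w => 4 * (expR (1 * X w) + expR (- 1 * X w)))) => //.
- exact: measurable_funX.
- move=> w; rewrite ger0_norm ?sqr_ge0//.
  by have := le_expR2 (X w); have := normr_ge0 (X w); lra.
- exact: integrable_EFinZl.
Qed.

(* Comparing the Taylor expansions of the moment generating function at 0
   identifies the two parameters of the law from the first two moments. *)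
Lemma gaussian_subgaussian (v : R) :
  ('E_P[X] = 0)%E -> \int[P]_w (X w ^+ 2) <= v ->
  (\int[P]_w (expR (X w))%:E <= (expR (v / 2))%:E)%E.
Proof.
move=> EX0 Ev; have [m [s E]] := gaussian_mgf gX.
set V := \int[P]_w (X w ^+ 2) in Ev.
have iX := gaussian_integrable; have iX2 := gaussian_integrable_sqr.
have iE := gaussian_integrable_expR.
have RX : \int[P]_w X w = 0.
  by move: EX0; rewrite unlock /Rintegral => ->.
pose K := 6 * (\int[P]_w (expR (2 * X w) + expR (- 2 * X w))).
(* Integrate the Taylor bound, whose linear term vanishes with the mean, and bound the exact moment
   generating function below by 1 + u <= exp u. *)
have key (l : R) : `|l| <= 1 ->
    l * m + l ^+ 2 * s ^+ 2 / 2 <= l ^+ 2 / 2 * V + `|l| ^+ 3 * K.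
  move=> l1.
  have H1 : \int[P]_w (expR (l * X w)) = expR (l * m + l ^+ 2 * s ^+ 2 / 2).
    by rewrite /Rintegral E.
  have i1 : P.-integrable setT (EFin \o (fun w => expR (2 * X w) + expR (- 2 * X w))).
    exact: integrable_EFinD.
  have i2 : P.-integrable setT (EFin \o (fun w =>
      `|l| ^+ 3 * 6 * (expR (2 * X w) + expR (- 2 * X w)))).
    exact: integrable_EFinZl.
  have i3 : P.-integrable setT (EFin \o (fun w => l ^+ 2 / 2 * X w ^+ 2)).
    exact: integrable_EFinZl.
  have i4 : P.-integrable setT (EFin \o (fun w => l * X w)).
    exact: integrable_EFinZl.
  have i5 : P.-integrable setT (EFin \o (fun w : Omega => 1 : R)).
    exact: finite_measure_integrable_cst.
  have i6 : P.-integrable setT (EFin \o (fun w => 1 + l * X w)).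
    exact: integrable_EFinD.
  have i7 : P.-integrable setT (EFin \o
      (fun w => 1 + l * X w + l ^+ 2 / 2 * X w ^+ 2)).
    exact: (integrable_EFinD i6 i3).
  have i8 : P.-integrable setT (EFin \o
      (fun w => 1 + l * X w + l ^+ 2 / 2 * X w ^+ 2 +
         `|l| ^+ 3 * 6 * (expR (2 * X w) + expR (- 2 * X w)))).
    exact: (integrable_EFinD i7 i2).
  have := @le_Rintegral _ _ _ P setT _ _ measurableT (iE l) i8
    (fun w _ => expR_scaled_le (X w) l1).
  rewrite H1 RintegralD// RintegralD// RintegralD// Rintegral_cst//.
  have -> : fine (P setT) = 1 by have -> := probability_setT P.
  rewrite mulr1 !RintegralZl// RX mulr0 addr0.
  rewrite -/V -[`|l| ^+ 3 * 6 * _]mulrA -/K.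
  have := expR_ge1Dx (l * m + l ^+ 2 * s ^+ 2 / 2); lra.
have K0 : 0 <= K.
  by rewrite mulr_ge0// Rintegral_ge0// => w _; rewrite addr_ge0 ?expR_ge0.
have V0 : 0 <= V by apply: Rintegral_ge0 => w _; exact: sqr_ge0.
(* If m is nonzero, [key] at l = sg(m) e gives e |m| = O(e^2), which fails once e (V + 2 K + 1) <=
   |m|. *)
have m0 : m = 0.
  apply/eqP/negPn/negP => m0; have nm : 0 < `|m| by rewrite normr_gt0.
  pose B := V + 2 * K + 1.
  have B0 : 0 < B by rewrite /B; lra.
  pose e := Num.min 1 (`|m| / B).
  have e0 : 0 < e by rewrite lt_min ltr01 divr_gt0.
  have e1 : e <= 1 by rewrite ge_min lexx.
  have eB : e * B <= `|m| by rewrite -ler_pdivlMr// ge_min lexx orbT.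
  have := key (Num.sg m * e).
  rewrite normrM normr_sg m0/= mul1r (ger0_norm (ltW e0)) => /(_ e1).
  rewrite mulrAC -normrEsg exprMn sqr_sg m0 mul1r => h.
  have e2 : 0 <= e ^+ 2 * s ^+ 2 / 2.
    by rewrite divr_ge0// mulr_ge0 ?sqr_ge0.
  have {h}: e * `|m| <= e * (e * (V / 2 + e * K)).
    by move: h; rewrite (_ : e * (e * _) = e ^+ 2 / 2 * V + e ^+ 3 * K); [lra|ring].
  rewrite ler_pM2l// => h.
  have : e * K <= K by rewrite ler_piMl.
  move=> eK; have : e * (V / 2 + e * K) <= e * (V / 2 + K).
    by rewrite ler_pM2l//; lra.
  move: eB; rewrite /B (_ : e * (V + 2 * K + 1) = 2 * (e * (V / 2 + K)) + e); last by field.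
  lra.
(* With m = 0, [key] at a small e > 0 compares coefficients of e^2: the error e^3 K stays below the
   gap e^2 (s^2 - V) / 2. *)
have s2 : s ^+ 2 <= V.
  rewrite leNgt; apply/negP => Vs; pose D := s ^+ 2 - V.
  have D0 : 0 < D by rewrite subr_gt0.
  have K1 : 0 < 4 * (K + 1) by lra.
  pose e := Num.min 1 (D / (4 * (K + 1))).
  have e0 : 0 < e by rewrite lt_min ltr01 divr_gt0.
  have e1 : e <= 1 by rewrite ge_min lexx.
  have eB : e * (4 * (K + 1)) <= D by rewrite -ler_pdivlMr// ge_min lexx orbT.
  have := key e; rewrite (ger0_norm (ltW e0)) m0 mulr0 add0r => /(_ e1) h.
  have {h} : e ^+ 2 * (D / 2) <= e ^+ 2 * (e * K).
    by rewrite /D; move: h; rewrite (_ : e ^+ 2 * (e * K) = e ^+ 3 * K); [lra|ring].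
  rewrite ler_pM2l ?exprn_gt0// => h.
  by move: eB; rewrite (_ : e * _ = 4 * (e * K) + 4 * e); [lra|ring].
have := E 1; rewrite m0; under eq_integral do rewrite mul1r.
move=> ->; rewrite lee_fin ler_expR; lra.
Qed.

End GaussianVariable.

Lemma integrable_mul_of_sqr d (T : measurableType d) (R : realType)
    (mu : {measure set T -> \bar R}) (X Y : T -> R) :
  measurable_fun setT X -> measurable_fun setT Y ->
  mu.-integrable setT (EFin \o (fun w => X w ^+ 2)) ->
  mu.-integrable setT (EFin \o (fun w => Y w ^+ 2)) ->
  mu.-integrable setT (EFin \o (fun w => X w * Y w)).
Proof.
move=> mX mY iX iY; apply: (@integrable_le_fin _ _ _ _ _
  (fun w => X w ^+ 2 + Y w ^+ 2)); last exact: integrable_EFinD.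
  exact: measurable_funM.
move=> w; rewrite normrM -(real_normK (num_real (X w))) -(real_normK (num_real (Y w))).
have := sqr_ge0 (`|X w| - `|Y w|); have := mulr_ge0 (normr_ge0 (X w)) (normr_ge0 (Y w)).
nra.
Qed.

(** Independence makes the joint law agree with the product measure on rectangles, hence everywhere;
    by Fubini the inner integral is a multiple of the mean of [Y]. *)
Lemma integral_mul_indep disp (Omega : measurableType disp) (R : realType)
    (P : probability Omega R) (X Y : {RV P >-> R}) :
  (forall A B : set R, measurable A -> measurable B ->
     P (X @^-1` A `&` Y @^-1` B) = (P (X @^-1` A) * P (Y @^-1` B))%E) ->
  P.-integrable setT (EFin \o X) -> P.-integrable setT (EFin \o Y) ->
  P.-integrable setT (EFin \o (fun w => X w * Y w)) ->
  (\int[P]_w (Y w)%:E = 0)%E ->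
  (\int[P]_w (X w * Y w)%:E = 0)%E.
Proof.
move=> indep iX iY iXY Y0.
have mZ : measurable_fun setT (fun w => (X w, Y w)) by exact: measurable_fun_pair.
pose Z : {mfun Omega >-> (R * R)%type} :=
  HB.pack (fun w => (X w, Y w)) (isMeasurableFun.Build _ _ _ _ _ mZ).
pose f (z : R * R) : \bar R := (z.1 * z.2)%:E.
have mf : measurable_fun setT f.
  by apply/measurable_EFinP; exact: measurable_funM.
pose m1 : probability R R := distribution P X.
pose m2 : probability R R := distribution P Y.
have E (A : set (R * R)) : measurable A -> A `<=` setT ->
    pushforward P Z A = (m1 \x m2)%E A.
  move=> mA _; apply/esym; apply: product_measure_unique. 2:{ by []. }
  move=> B C mB mC; exact: indep.
have i1 : (pushforward P Z).-integrable setT f.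
  by apply: integrable_pushforward => //; rewrite preimage_setT.
have i2 : (m1 \x m2)%E.-integrable setT f.
  apply/integrableP; split=> //; move/integrableP: i1 => [_].
  by rewrite (eq_measure_integral _ E).
transitivity (\int[pushforward P Z]_z f z)%E.
  by rewrite integral_pushforward ?preimage_setT.
transitivity (\int[(m1 \x m2)%E]_z f z)%E; first exact: eq_measure_integral.
rewrite -(integral12_prod_meas1 i2).
rewrite /fubini_F; under eq_integral => x _.
  rewrite /f/=; under eq_integral do rewrite EFinM.
  have iy : m2.-integrable setT (EFin : R -> \bar R).
    by apply: integrable_pushforward => //; rewrite preimage_setT.
  rewrite integralZl//.
  have -> : (\int[m2]_y y%:E = 0)%E.
    by rewrite integral_pushforward ?preimage_setT//; exact: measurable_EFin.
  rewrite mule0; over.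
by rewrite integral0.
Qed.

(** * Gaussian tensors with independent entries *)

Section SortedIndex.
Variables (d r : nat).
Implicit Types i j : r.-tuple 'I_d.

Let leo := relpre (@nat_of_ord d) leq.

(** The representative of the permutation orbit of [i]. Independence is assumed only between entries
    at such indices, so symmetry is used to move every entry there. *)
Definition sorted_index i : r.-tuple 'I_d := [tuple of sort leo i].

Lemma sorted_index_perm i :
  exists s : 'S_r, sorted_index i = [tuple tnth i (s k) | k < r].
Proof.
have /tuple_permP[s E] : perm_eq (sorted_index i) i by rewrite perm_sort.
by exists s; apply: val_inj.
Qed.

Lemma nondecreasing_sorted_index i : nondecreasing_index (sorted_index i).
Proof.
have leoT : total leo by move=> a b; exact: leq_total.
have leo_tr : transitive leo by move=> a b c; exact: leq_trans.
have srt : sorted leo (sorted_index i) by exact: sort_sorted.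
apply/forallP => k; apply/forallP => l; apply/implyP => kl.
have x0 := tnth i k.
rewrite !(tnth_nth x0).
apply: (sorted_leq_nth leo_tr _ x0 srt) => //; rewrite ?inE ?size_tuple ?ltn_ord//.
Qed.

(** An orbit is the image of the symmetric group, hence has at most r! elements. This is the source
    of the factor r! in the variance bound. *)
Lemma card_sorted_index i :
  (#|[pred j | sorted_index j == sorted_index i]| <= r`!)%N.
Proof.
pose f (s : 'S_r) : r.-tuple 'I_d := [tuple tnth i (s k) | k < r].
apply: (@leq_trans #|f @: [set: 'S_r]%SET|); last first.
  by apply: leq_trans (leq_imset_card _ _) _; rewrite cardsT card_Sn.
apply/subset_leq_card/fintype.subsetP => j; rewrite inE => /eqP ji.
have /tuple_permP[s E] : perm_eq j i.
  have E : sort leo j = sort leo i by exact: (congr1 val ji).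
  by rewrite -(perm_sort leo j) E perm_sort.
by apply/imsetP; exists s => //; exact: val_inj.
Qed.

End SortedIndex.

Lemma Rintegral_sum d (T : measurableType d) (R : realType)
    (mu : {measure set T -> \bar R}) (I : Type) (s : seq I) (f : I -> T -> R) :
  (forall i, mu.-integrable setT (EFin \o f i)) ->
  mu.-integrable setT (EFin \o (fun w => \sum_(i <- s) f i w)) /\
  \int[mu]_w (\sum_(i <- s) f i w) = \sum_(i <- s) \int[mu]_w f i w.
Proof.
move=> fi; elim: s => [|i s [IH1 IH2]].
  have -> : (fun w => \sum_(i <- [::]) f i w) = cst 0.
    by apply/funext => w; rewrite big_nil.
  split; first exact: integrable0.
  by rewrite big_nil /Rintegral integral0.
have -> : (fun w => \sum_(j <- i :: s) f j w) =
          (fun w => f i w + \sum_(j <- s) f j w).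
  by apply/funext => w; rewrite big_cons.
split; first exact: integrable_EFinD.
by rewrite RintegralD// big_cons IH2.
Qed.

Section VarianceTensor.
Context disp (Omega : measurableType disp) (R : realType)
  (P : probability Omega R) (d r : nat) (T : r.-tuple 'I_d -> {RV P >-> R}).
Hypothesis Tsym : forall w : Omega, symmetric_tensor (realization T w).
Hypothesis Tgauss : jointly_gaussian T.
Hypothesis Tmean : forall i, ('E_P[T i] = 0)%E.
Hypothesis Tindep : mutually_independent (@nondecreasing_index d r) T.

Lemma entry_sorted i w : T (sorted_index i) w = T i w.
Proof.
have [s ->] := sorted_index_perm i.
by have := Tsym w s i; rewrite !ffunE.
Qed.

Lemma entry_gaussian i : gaussian_rv P (T i).
Proof.
have := Tgauss (fun j => (j == i)%:R).
congr gaussian_rv; apply/funext => w; rewrite (bigD1 i)//= eqxx mul1r.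
by rewrite big1 ?addr0// => j /negPf ->; rewrite mul0r.
Qed.

Let iT i := gaussian_integrable (entry_gaussian i).
Let iT2 i := gaussian_integrable_sqr (entry_gaussian i).

Lemma integrable_entry_mul i j :
  P.-integrable setT (EFin \o (fun w => T i w * T j w)).
Proof. by apply: integrable_mul_of_sqr. Qed.

Lemma variance_tensorE i :
  variance_tensor T i = \int[P]_w (T i w ^+ 2).
Proof. by rewrite ffunE unlock. Qed.

Lemma entry_covariance i j : sorted_index i != sorted_index j ->
  \int[P]_w (T i w * T j w) = 0.
Proof.
move=> ij; rewrite /Rintegral.
under eq_integral do rewrite -(entry_sorted i) -(entry_sorted j).
rewrite integral_mul_indep//.
- move=> A B mA mB.
  have := Tindep (J := [set sorted_index i; sorted_index j]%SET).
  (* The event [A] is attached to the first sorted index and [B] to the second; the two indices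
     differ. *)
  move=> /(_ _ (fun k => if k == sorted_index i then A else B)).
  have Jsub : [set sorted_index i; sorted_index j]%SET \subset
      [pred k | nondecreasing_index k].
    by apply/fintype.subsetP => k; rewrite !inE => /orP[]/eqP->;
      exact: nondecreasing_sorted_index.
  move=> /(_ Jsub); rewrite big_setU1 ?inE//= big_set1 eqxx eq_sym (negbTE ij) => <-.
    congr (P _); apply/seteqP; split=> w /=.
      move=> [Ai Bj] k /=; rewrite !inE => /orP[]/eqP->; rewrite ?eqxx//.
      by rewrite eq_sym (negbTE ij).
    move=> H; split.
      by have := H (sorted_index i); rewrite /= !inE eqxx; exact.
    have := H (sorted_index j); rewrite /= !inE eqxx orbT eq_sym (negbTE ij).
    exact.
  by move=> k; case: ifP.
- exact: integrable_entry_mul.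
- by have := Tmean (sorted_index j); rewrite unlock.
Qed.

Lemma variance_tensor_ge0 i : 0 <= variance_tensor T i.
Proof. by rewrite variance_tensorE Rintegral_ge0// => w _; exact: sqr_ge0. Qed.

Lemma variance_tensor_sorted i :
  variance_tensor T (sorted_index i) = variance_tensor T i.
Proof.
rewrite !variance_tensorE; congr (Rintegral _ _ _).
by apply/funext => w; rewrite entry_sorted.
Qed.

(** Expand the square. Only pairs in the same orbit contribute, each with S_i S_j A_i <= (A_i S_i^2
    + A_j S_j^2) / 2, and an index has at most r! partners. *)
Lemma second_moment_le (S : r.-tuple 'I_d -> R) :
  \int[P]_w ((\sum_i S i * T i w) ^+ 2)
  <= r`!%:R * \sum_i variance_tensor T i * S i ^+ 2.
Proof.
set A := variance_tensor T.
have -> : (fun w => (\sum_i S i * T i w) ^+ 2) =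
  (fun w => \sum_(i : r.-tuple 'I_d) \sum_(j : r.-tuple 'I_d)
     S i * S j * (T i w * T j w)).
  apply/funext => w; rewrite expr2 big_distrl/=; apply: eq_bigr => i _.
  by rewrite big_distrr/=; apply: eq_bigr => j _; ring.
have i1 i j : P.-integrable setT (EFin \o (fun w => S i * S j * (T i w * T j w))).
  by apply: integrable_EFinZl; exact: integrable_entry_mul.
have i2 i := Rintegral_sum (index_enum _) (i1 i).
have i3 i := (i2 i).1.
have [_ ->] := Rintegral_sum (index_enum _) i3.
pose e (i j : r.-tuple 'I_d) := (sorted_index j == sorted_index i).
have cov i j : S i * S j * \int[P]_w (T i w * T j w)
    <= (e i j)%:R * (2^-1 * (A i * S i ^+ 2) + 2^-1 * (A j * S j ^+ 2)).
  rewrite /e; case: eqVneq => [Eij|nij]; last first.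
    by rewrite mul0r entry_covariance ?mulr0// eq_sym.
  have -> : \int[P]_w (T i w * T j w) = A i.
    rewrite /A variance_tensorE; congr (Rintegral _ _ _); apply/funext => w.
    by rewrite -(entry_sorted j) Eij entry_sorted expr2.
  have -> : A j = A i by rewrite -variance_tensor_sorted Eij variance_tensor_sorted.
  rewrite mul1r; have := variance_tensor_ge0 i; rewrite -/A => A0.
  have := mulr_ge0 A0 (sqr_ge0 (S i - S j)); nra.
apply: (@le_trans _ _ (\sum_i \sum_j
    (e i j)%:R * (2^-1 * (A i * S i ^+ 2) + 2^-1 * (A j * S j ^+ 2)))).
  apply: ler_sum => i _; rewrite (i2 i).2; apply: ler_sum => j _.
  rewrite RintegralZl//; exact: integrable_entry_mul.
under eq_bigr do under eq_bigr do rewrite mulrDr.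
under eq_bigr do rewrite big_split/=.
rewrite big_split/= [X in _ + X]exchange_big/=.
have -> : \sum_j \sum_i (e i j)%:R * (2^-1 * (A j * S j ^+ 2)) =
  \sum_i \sum_j (e i j)%:R * (2^-1 * (A i * S i ^+ 2)).
  by apply: eq_bigr => i _; apply: eq_bigr => j _; rewrite /e eq_sym.
rewrite -mulr2n -[leLHS]mulr_natl mulr_sumr mulr_sumr; apply: ler_sum => i _.
have -> : \sum_j (e i j)%:R * (2^-1 * (A i * S i ^+ 2)) =
  #|[pred j | sorted_index j == sorted_index i]|%:R * (2^-1 * (A i * S i ^+ 2)).
  rewrite -mulr_suml -natr_sum -sum1_card [in RHS]big_mkcond/=.
  by congr (_%:R * _); apply: eq_bigr => j _; rewrite /e inE; case: eqP.
rewrite mulrCA mulrA -[_ * (2^-1 * _)]mulrA mulVKf//.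
apply: ler_wpM2r; first by rewrite mulr_ge0 ?variance_tensor_ge0 ?sqr_ge0.
by rewrite ler_nat; exact: card_sorted_index.
Qed.

Lemma measurable_pairing (c : r.-tuple 'I_d -> R) :
  measurable_fun setT (fun w => \sum_i c i * T i w).
Proof. by apply: measurable_sum => i; exact: measurable_funM. Qed.

(** By joint Gaussianity the pairing is one centered Gaussian variable, to which the scalar bound
    applies. *)
Lemma pairing_subgaussian (c : r.-tuple 'I_d -> R) :
  (\int[P]_w (expR (\sum_i c i * T i w))%:E
   <= (expR (r`!%:R * (\sum_i variance_tensor T i * c i ^+ 2) / 2))%:E)%E.
Proof.
have mG := measurable_pairing c.
pose G : {RV P >-> R} :=
  HB.pack (fun w => \sum_i c i * T i w) (isMeasurableFun.Build _ _ _ _ _ mG).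
apply: (@gaussian_subgaussian _ _ _ _ G); first exact: Tgauss.
  have icT i : P.-integrable setT (EFin \o (fun w => c i * T i w)).
    apply: integrable_EFinZl; exact: iT.
  rewrite unlock; have -> : (fun w => (G w)%:E) =
     (fun w => \sum_(i : r.-tuple 'I_d) (c i * T i w)%:E)%E.
    by apply/funext => w; rewrite /= sumEFin.
  rewrite integral_sum//; apply: big1 => i _.
  under eq_integral do rewrite EFinM.
  rewrite integralZl//; last exact: iT.
  by have := Tmean i; rewrite unlock => ->; rewrite mule0.
exact: second_moment_le.
Qed.

End VarianceTensor.

(** * Randomized rounding and entropy *)

Section ProductWeights.
Variables (R : realType) (I E : finType).
Implicit Types (w F : I -> E -> R) (u : {ffun I -> E}).

(** The product of the weights [w i]: the coordinates of [u] are independent. *)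
Definition prod_weight w u : R := \prod_i w i (u i).

Lemma sum_prod_weight_prod w F :
  \sum_u prod_weight w u * \prod_i F i (u i) = \prod_i \sum_e w i e * F i e.
Proof.
rewrite (bigA_distr_bigA (fun i e => w i e * F i e))/=.
by apply: eq_bigr => u _; rewrite /prod_weight -big_split.
Qed.

Variable w : I -> E -> R.
Hypothesis w1 : forall i, \sum_e w i e = 1.

Lemma sum_prod_weight : \sum_u prod_weight w u = 1.
Proof.
transitivity (\sum_u prod_weight w u * \prod_(i : I) 1).
  by apply: eq_bigr => u _; rewrite big1_eq mulr1.
rewrite (sum_prod_weight_prod w (fun _ _ => 1)); apply: big1 => i _.
by under eq_bigr do rewrite mulr1.
Qed.

Lemma sum_prod_weight2 (i j : I) (f g : E -> R) : i != j ->
  \sum_u prod_weight w u * (f (u i) * g (u j)) =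
  (\sum_e w i e * f e) * (\sum_e w j e * g e).
Proof.
move=> ij.
have := sum_prod_weight_prod w
  (fun k e => if k == i then f e else if k == j then g e else 1).
have E1 (H : I -> R) : (forall k, k != i -> k != j -> H k = 1) ->
    \prod_k H k = H i * H j.
  move=> H1; rewrite (bigD1 i)//= (bigD1 j) ?[j == i]eq_sym//=.
  by rewrite big1 ?mulr1// => k /andP[ki kj]; exact: H1.
rewrite E1; last first.
  move=> k ki kj; rewrite (negbTE ki) (negbTE kj).
  by under eq_bigr do rewrite mulr1.
rewrite eqxx eq_sym (negbTE ij) eqxx => <-; apply: eq_bigr => u _.
rewrite E1; last by move=> k ki kj; rewrite (negbTE ki) (negbTE kj).
by rewrite eqxx eq_sym (negbTE ij) eqxx.
Qed.

Lemma sum_prod_weight1 (i : I) (f : E -> R) :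
  \sum_u prod_weight w u * f (u i) = \sum_e w i e * f e.
Proof.
have := sum_prod_weight_prod w (fun k e => if k == i then f e else 1).
have E1 (H : I -> R) : (forall k, k != i -> H k = 1) -> \prod_k H k = H i.
  by move=> H1; rewrite (bigD1 i)//= big1 ?mulr1.
rewrite E1; last first.
  by move=> k ki; rewrite (negbTE ki); under eq_bigr do rewrite mulr1.
rewrite eqxx => <-; apply: eq_bigr => u _.
rewrite E1; last by move=> k ki; rewrite (negbTE ki).
by rewrite eqxx.
Qed.

End ProductWeights.

(* [w] is a probability whose relative entropy with respect to the measure of
   constant weight [q] is at most [K]; the density is only bounded from above,
   by [expR h], so that no logarithm is needed. *)
Definition entropy_le (R : realType) (E : finType) (q : R) (w : E -> R) (K : R) :=
  [/\ forall e, 0 <= w e, \sum_e w e = 1 &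
   exists2 h : E -> R, forall e, w e <= q * expR (h e) & \sum_e w e * h e <= K].

(** Entropy is additive over independent coordinates: the sum of the functions [h i] bounds the
    log-density of the product, and its mean involves only the marginals. *)
Lemma entropy_le_prod (R : realType) (I E : finType) (q : R)
    (w : I -> E -> R) (K : I -> R) : 0 <= q ->
  (forall i, entropy_le q (w i) (K i)) ->
  entropy_le (q ^+ #|I|) (prod_weight w) (\sum_i K i).
Proof.
move=> q0 wK.
have w0 i e : 0 <= w i e by case: (wK i).
have w1 i : \sum_e w i e = 1 by case: (wK i).
have hE i : exists h : E -> R,
    (forall e, w i e <= q * expR (h e)) /\ \sum_e w i e * h e <= K i.
  by have [_ _ [h h1 h2]] := wK i; exists h.
have [h hP] := choice hE.
split; first by move=> u; exact: prodr_ge0.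
  exact: sum_prod_weight.
exists (fun u : {ffun I -> E} => \sum_i h i (u i)) => [u|].
  rewrite expR_sum -prodr_const -big_split/=.
  by apply: ler_prod => i _; rewrite w0 (hP i).1.
under eq_bigr do rewrite mulr_sumr.
rewrite exchange_big/=; apply: ler_sum => i _.
by rewrite sum_prod_weight1// (hP i).2.
Qed.

(* Weak form of the Donsker-Varadhan variational inequality, with
   [ln Z <= Z - 1]. *)
Lemma entropy_le_variational (R : realType) (E : finType) (q : R) (w : E -> R)
    (K : R) (f : E -> R) : entropy_le q w K ->
  \sum_e w e * f e <= \sum_e q * expR (f e) - 1 + K.
Proof.
move=> [w0 w1 [h wh hK]].
have H e : w e * f e <= q * expR (f e) - w e + w e * h e.
  (* The inequality 1 + u <= exp u at u = f - h; the density bound w <= q exp h then turns exp(f -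
     h) into q exp f. *)
  have e1 : w e * (1 + (f e - h e)) <= w e * expR (f e - h e).
    by apply: ler_wpM2l => //; exact: expR_ge1Dx.
  have e2 : w e * expR (f e - h e) <= q * expR (h e) * expR (f e - h e).
    by rewrite ler_wpM2r ?expR_ge0.
  have e3 : q * expR (h e) * expR (f e - h e) = q * expR (f e).
    by rewrite -mulrA -expRD addrC subrK.
  rewrite e3 in e2; have := le_trans e1 e2; lra.
apply: (le_trans (ler_sum _ (fun e _ => H e))).
by rewrite big_split/= big_split/= sumrN w1 lerD2l.
Qed.

Section Signs.
Variable R : realType.

Definition sgb (b : bool) : R := if b then 1 else -1.
(** The law of a random sign with mean [a]. *)
Definition bias (a : R) (b : bool) : R := (1 + a * sgb b) / 2.

Lemma sum_bias a : \sum_b bias a b = 1.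
Proof. by rewrite big_bool /bias /sgb/=; field. Qed.

Lemma sum_bias_sgb a : \sum_b bias a b * sgb b = a.
Proof. by rewrite big_bool /bias /sgb/=; field. Qed.

Lemma sgb_sqr b : sgb b * sgb b = 1.
Proof. by case: b; rewrite /sgb ?mulr1// mulrNN mulr1. Qed.

Lemma bias_ge0 a b : `|a| <= 1 -> 0 <= bias a b.
Proof. by rewrite ler_norml /bias /sgb => /andP[? ?]; case: b; lra. Qed.

(** With respect to a fair sign the density is 1 + a sgn <= exp(a sgn), and the mean of the exponent
    a sgn is a^2. *)
Lemma entropy_le_bias a : `|a| <= 1 -> entropy_le 2^-1 (bias a) (a ^+ 2).
Proof.
move=> a1; split; [by move=> b; exact: bias_ge0|exact: sum_bias|].
exists (fun b => a * sgb b) => [b|].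
  by rewrite /bias mulrC ler_wpM2l ?invr_ge0// expR_ge1Dx.
under eq_bigr do rewrite mulrCA.
by rewrite -mulr_sumr sum_bias_sgb expr2.
Qed.

End Signs.

(* Randomized rounding: a vector is the mean of a random point of the grid
   with mesh [s], a sum of [N] steps [+s] or [-s] in each coordinate. *)
Section Rounding.
Variables (R : realType) (d N : nat) (s : R).
Hypotheses (N0 : (0 < N)%N) (s0 : 0 < s).

Definition grid := {ffun 'I_d * 'I_N -> bool}.

Definition grid_point (e : grid) (j : 'I_d) : R := s * \sum_(l < N) sgb R (e (j, l)).

(** Independent signs of mean x_j / (N s), so that s times the sum of the N signs of coordinate j
    has mean x_j. *)
Definition rounding (x : 'I_d -> R) : grid -> R :=
  prod_weight (fun jl => bias (x jl.1 / (N%:R * s))).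

Variable x : 'I_d -> R.
Hypothesis xN : forall j, `|x j| <= N%:R * s.

Let Ns0 : 0 < N%:R * s. Proof. by rewrite mulr_gt0 ?ltr0n. Qed.

Let a (jl : 'I_d * 'I_N) := x jl.1 / (N%:R * s).

Let a1 jl : `|a jl| <= 1.
Proof. by rewrite normrM normfV (gtr0_norm Ns0) ler_pdivrMr// mul1r. Qed.

(** Each of the N signs of coordinate j costs (x_j / (N s))^2, in total x_j^2 / (N s^2). *)
Lemma entropy_le_rounding : entropy_le (2^-1 ^+ (d * N)) (rounding x)
  (\sum_j x j ^+ 2 / (N%:R * s ^+ 2)).
Proof.
have := entropy_le_prod _ (fun jl => entropy_le_bias (a1 jl)).
rewrite invr_ge0 ler0n card_prod !card_ord => /(_ isT).
rewrite /rounding (_ : \sum_i a i ^+ 2 = \sum_j x j ^+ 2 / (N%:R * s ^+ 2))//.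
rewrite -(pair_bigA _ (fun j l => a (j, l) ^+ 2))/=.
apply: eq_bigr => j _; rewrite /a/= sumr_const card_ord -mulr_natl.
have Nn : N%:R != 0 :> R by rewrite pnatr_eq0 -lt0n.
by field; rewrite Nn gt_eqF.
Qed.

Lemma sum_rounding : \sum_e rounding x e = 1.
Proof. by case: entropy_le_rounding. Qed.

Lemma rounding_ge0 e : 0 <= rounding x e.
Proof. by case: entropy_le_rounding. Qed.

Let bias1 jl : \sum_b bias (a jl) b = 1. Proof. exact: sum_bias. Qed.

Lemma rounding_mean j : \sum_e rounding x e * grid_point e j = x j.
Proof.
under eq_bigr do rewrite /grid_point mulrCA mulr_sumr.
rewrite -mulr_sumr exchange_big/=.
under eq_bigr do rewrite (sum_prod_weight1 bias1 (j, _) (sgb R)) sum_bias_sgb.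
rewrite /a/= sumr_const card_ord -mulr_natl.
have Nn : N%:R != 0 :> R by rewrite pnatr_eq0 -lt0n.
by field; rewrite Nn gt_eqF.
Qed.

(** Distinct signs are uncorrelated and contribute b^2 each, while a diagonal term is at most b^2 +
    1; the N diagonal excesses give N s^2. *)
Lemma rounding_sqr j :
  \sum_e rounding x e * grid_point e j ^+ 2 <= x j ^+ 2 + N%:R * s ^+ 2.
Proof.
have aN : a (j, Ordinal N0) = x j / (N%:R * s) by [].
set b := x j / (N%:R * s) in aN.
have cov (l m : 'I_N) : \sum_e rounding x e *
    (sgb R (e (j, l)) * sgb R (e (j, m))) <= b ^+ 2 + (l == m)%:R.
  have [<-|lm] := eqVneq l m.
    under eq_bigr do rewrite sgb_sqr mulr1.
    by rewrite sum_rounding lerDr sqr_ge0.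
  have jlm : (j, l) != (j, m) by rewrite xpair_eqE eqxx.
  by rewrite (sum_prod_weight2 bias1 _ _ jlm) !sum_bias_sgb addr0 expr2.
have -> : \sum_e rounding x e * grid_point e j ^+ 2 =
    s ^+ 2 * \sum_(l < N) \sum_(m < N) \sum_e rounding x e *
      (sgb R (e (j, l)) * sgb R (e (j, m))).
  rewrite (eq_bigr (fun l => \sum_e \sum_(m < N) rounding x e *
      (sgb R (e (j, l)) * sgb R (e (j, m))))); last first.
    by move=> l _; rewrite exchange_big.
  rewrite exchange_big/= mulr_sumr; apply: eq_bigr => e _.
  rewrite /grid_point exprMn mulrCA; congr (_ * _).
  rewrite expr2 big_distrl/= mulr_sumr; apply: eq_bigr => l _.
  by rewrite big_distrr/= mulr_sumr.
apply: (@le_trans _ _ (s ^+ 2 * \sum_(l < N) \sum_(m < N) (b ^+ 2 + (l == m)%:R))).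
  rewrite ler_wpM2l ?sqr_ge0//; apply: ler_sum => l _.
  by apply: ler_sum => m _; exact: cov.
have row (l : 'I_N) : \sum_(m < N) (b ^+ 2 + (l == m)%:R) = N%:R * b ^+ 2 + 1.
  rewrite big_split/= sumr_const card_ord mulr_natl (bigD1 l)//= eqxx.
  by rewrite big1 ?addr0// => m; rewrite eq_sym => /negbTE ->.
rewrite (eq_bigr _ (fun l _ => row l)) sumr_const card_ord -[_ *+ N]mulr_natl.
have Nn : N%:R != 0 :> R by rewrite pnatr_eq0 -lt0n.
rewrite le_eqVlt; apply/orP; left; apply/eqP.
by rewrite /b; field; rewrite Nn gt_eqF.
Qed.

End Rounding.

(** * Injective norms *)

Section Lnorm.
Variables (R : realType) (d : nat).
Implicit Types (x : 'rV[R]_d) (p a e : R).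

Lemma powR_le1 a e : 0 <= a -> 0 < e -> (a `^ e <= 1) = (a <= 1).
Proof.
move=> a0 e0; have mono := @ge0_ler_powR R.
apply/idP/idP => a1.
  rewrite -[leLHS](powRr1 a0) -[in leLHS](mulfV (lt0r_neq0 e0)) powRrM.
  have ie : 0 <= e^-1 by rewrite invr_ge0 ltW.
  have := mono _ ie (a `^ e) 1 _ _ a1; rewrite /= powR1.
  by apply; rewrite ?nnegrE ?powR_ge0.
have := mono e (ltW e0) a 1 _ _ a1; rewrite /= powR1.
by apply; rewrite ?nnegrE.
Qed.

Lemma lnorm_le1 p x : 0 < p -> (lnorm p x <= 1) = (\sum_j `|x 0 j| `^ p <= 1).
Proof.
move=> p0; rewrite /lnorm powR_le1 ?invr_gt0//.
by apply: sumr_ge0 => j _; exact: powR_ge0.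
Qed.

Lemma lnorm0_le1 p : 0 < p -> lnorm p (0 : 'rV[R]_d) <= 1.
Proof.
move=> p0; rewrite lnorm_le1// big1// => j _.
by rewrite mxE normr0 powR0// gt_eqF.
Qed.

Lemma lnorm_entry p x j : 0 < p -> lnorm p x <= 1 -> `|x 0 j| <= 1.
Proof.
move=> p0; rewrite lnorm_le1// -(powR_le1 (normr_ge0 _) p0); apply: le_trans.
rewrite (bigD1 j)//= lerDl; apply: sumr_ge0 => k _; exact: powR_ge0.
Qed.

(** This is where p / 2 enters: the variance of a pairing involves the squared coordinates. *)
Lemma lnorm_sqr p x : 0 < p -> lnorm p x <= 1 ->
  lnorm (p / 2) (\row_j x 0 j ^+ 2) <= 1.
Proof.
move=> p0; rewrite !lnorm_le1 ?divr_gt0// => /(le_trans _); apply.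
apply: ler_sum => j _; rewrite mxE normrX -powR_mulrn// -powRrM.
by rewrite mulrCA mulfV// mulr1.
Qed.

(* Young's inequality applied to each coordinate, with the weight for which
   the vector with constant entries is the equality case. *)
Lemma lnorm_sum_sqr p x : 2 <= p -> (0 < d)%N -> lnorm p x <= 1 ->
  \sum_j x 0 j ^+ 2 <= d%:R `^ (1 - 2 / p).
Proof.
move=> p2 d0; have p0 : 0 < p by lra.
rewrite lnorm_le1// => xp.
have dR : 0 < d%:R :> R by rewrite ltr0n.
have sqrE j : x 0 j ^+ 2 = `|x 0 j| ^+ 2 by rewrite real_normK ?num_real.
(* At p = 2 the exponent conjugate to p / 2 is infinite, and the bound is immediate. *)
have [pE|pn2] := eqVneq p 2.
  rewrite pE divff// subrr powRr0; apply: le_trans xp; rewrite pE.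
  by apply: ler_sum => j _; rewrite sqrE powR_mulrn.
have q0 : 0 < 1 - 2 / p.
  by rewrite subr_gt0 ltr_pdivrMr// mul1r lt_neqAle eq_sym pn2.
pose q := (1 - 2 / p)^-1.
have pq : (p / 2)^-1 + q^-1 = 1 by rewrite /q invrK invf_div; ring.
set b := d%:R `^ (1 - 2 / p).
have b0 : 0 < b by exact: powR_gt0.
rewrite -[leRHS]mul1r -ler_pdivrMr// mulr_suml.
(* Young's inequality for x_j^2 and 1 / b with exponents p / 2 and q; by the choice of b, b^(-q) = 1
   / d. *)
have Y j : x 0 j ^+ 2 / b <= (p / 2)^-1 * `|x 0 j| `^ p + q^-1 * d%:R^-1.
  have /conjugate_powR := sqr_ge0 (x 0 j).
  move=> /(_ b^-1 (p / 2) q); rewrite invr_ge0 (ltW b0) divr_gt0// invr_gt0 q0.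
  move=> /(_ isT isT isT pq) /le_trans; apply.
  rewrite [X in X + _]mulrC [X in _ + X]mulrC.
  rewrite sqrE -powR_mulrn// -powRrM mulrCA mulfV// mulr1 lerD2l.
  by rewrite /b -powRN -powRrM mulNr mulfV ?gt_eqF// powRN powRr1.
apply: (le_trans (ler_sum _ (fun j _ => Y j))).
rewrite big_split/= -mulr_sumr sumr_const card_ord -[_ *+ d]mulr_natl.
rewrite mulrCA mulfV ?gt_eqF// mulr1 -[leRHS]pq lerD2r ler_piMr// invr_ge0.
by rewrite divr_ge0// ltW.
Qed.

End Lnorm.

Section Injnorm.
Variables (R : realType) (d : nat) (p : R).
Hypothesis p0 : 0 < p.

(** The supremum is finite: unit vectors have entries at most 1 in absolute value, so the sum of the
    |S_i| bounds every pairing. *)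
Lemma rank1_pairing_le_injnorm m (S : tensor R d m) (x : 'I_m -> 'rV[R]_d) :
  (forall k, lnorm p (x k) <= 1) -> rank1_pairing S x <= injnorm p S.
Proof.
case: m S x => [|m] S x xp.
  rewrite /rank1_pairing/= (bigD1 [tuple])//= big_ord0 mulr1 big1 ?addr0 ?ler_norm//.
  by move=> i /eqP[]; exact: tuple0.
apply: sup_upper_bound; last by exists x.
split; first by exists (rank1_pairing S x), x.
exists (\sum_i `|S i|) => _ [y yp <-]; apply: ler_sum => i _.
apply: (le_trans (ler_norm _)); rewrite normrM ler_piMr// normr_prod.
by apply: prodr_ile1 => k _; rewrite normr_ge0/=; exact: lnorm_entry (yp k).
Qed.

Lemma injnorm_ge0 m (S : tensor R d m) : 0 <= injnorm p S.
Proof.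
case: m S => [|m] S; first exact: normr_ge0.
have := @rank1_pairing_le_injnorm m.+1 S (fun _ => 0) (fun _ => lnorm0_le1 _ p0).
rewrite /rank1_pairing big1// => i _.
by rewrite big_ord_recl mxE mul0r mulr0.
Qed.

Lemma injnorm_le m (S : tensor R d m) (M : R) : (0 < m)%N ->
  (forall x : 'I_m -> 'rV[R]_d, (forall k, lnorm p (x k) <= 1) ->
     rank1_pairing S x <= M) ->
  injnorm p S <= M.
Proof.
case: m S => // m S _ SM; apply: ge_sup; last by move=> _ [x xp <-]; exact: SM.
by exists (rank1_pairing S (fun _ => 0)), (fun _ => 0) => // k; exact: lnorm0_le1.
Qed.

End Injnorm.

(** * Contractions of symmetric tensors *)

Lemma sum_tuple_cat (R : realType) (T : finType) (m n r : nat) (e : (m + n)%N = r)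
    (G : r.-tuple T -> R) :
  \sum_i G i = \sum_(j : m.-tuple T) \sum_(k : n.-tuple T)
                 G (tcast e [tuple of j ++ k]).
Proof.
case: r / e G => G; rewrite pair_big/=.
pose h (i : (m + n).-tuple T) : m.-tuple T * n.-tuple T :=
  ([tuple tnth i (lshift n k) | k < m], [tuple tnth i (rshift m k) | k < n]).
rewrite (reindex (fun jk : m.-tuple T * n.-tuple T => [tuple of jk.1 ++ jk.2]))/=.
  by apply: eq_bigr => -[j k] _.
exists h => [[j k] _|i _].
  by congr pair; apply: eq_from_tnth => l; rewrite tnth_mktuple ?tnth_lshift ?tnth_rshift.
apply: eq_from_tnth => l; rewrite -[l]splitK; case: (fintype.split l) => a /=.
  by rewrite tnth_lshift tnth_mktuple.
by rewrite tnth_rshift tnth_mktuple.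
Qed.

(** Where the factors are 1, summation contracts the index. The factors are indexed by [nat] so that
    one family serves for both orders r and m. *)
Lemma sum_tensor_ignore_tail (R : realType) (d m n r : nat) (e : (m + n)%N = r)
    (A : r.-tuple 'I_d -> R) (c : nat -> 'I_d -> R) :
  (forall k a, (m <= k)%N -> c k a = 1) ->
  \sum_i A i * \prod_(k < r) c k (tnth i k) =
  \sum_(j : m.-tuple 'I_d)
    (\sum_(k : n.-tuple 'I_d) A (tcast e [tuple of j ++ k]))
      * \prod_(l < m) c l (tnth j l).
Proof.
move=> c1; rewrite (sum_tuple_cat e); apply: eq_bigr => j _.
rewrite mulr_suml; apply: eq_bigr => k _; congr (_ * _).
case: r / e A => A; rewrite big_split_ord/= [X in _ * X]big1 ?mulr1.
  by apply: eq_bigr => l _; rewrite tnth_lshift.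
by move=> l _; rewrite c1// leq_addr.
Qed.

Lemma sum_tensor_perm (R : realType) (d r : nat) (A : tensor R d r)
    (s : {perm 'I_r}) (c : 'I_r -> 'I_d -> R) : symmetric_tensor A ->
  \sum_i A i * \prod_k c k (tnth i k) =
  \sum_i A i * \prod_k c (s k) (tnth i k).
Proof.
move=> Asym.
pose f (v : {perm 'I_r}) (i : r.-tuple 'I_d) := [tuple tnth i (v k) | k < r].
rewrite [RHS](reindex (f s))/=; last first.
  exists (f s^-1%g) => i _; apply: eq_from_tnth => k;
    by rewrite !tnth_mktuple ?permK ?permKV.
apply: eq_bigr => i _; rewrite /f Asym; congr (_ * _).
rewrite (reindex_inj (@perm_inj _ s)); apply: eq_bigr => k _.
by rewrite tnth_mktuple.
Qed.

Section Contraction.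
Variables (R : realType) (d r : nat) (p : R) (A : tensor R d r).
Hypotheses (p0 : 0 < p) (r0 : (0 < r)%N) (Asym : symmetric_tensor A).

(** By symmetry the positions in [J] can be moved to the end, where [contract1] sums them out. *)
Lemma sum_tensor_subset_le (x : 'I_r -> 'rV[R]_d) (J : {set 'I_r}) q
    (hq : (q <= r)%N) : #|J| = q -> (forall k, lnorm p (x k) <= 1) ->
  \sum_i A i * \prod_k (if k \in J then 1 else x k 0 (tnth i k))
  <= injnorm p (contract1 hq A).
Proof.
move=> Jq xp; pose k0 := Ordinal r0.
(* The permutation lists the complement of [J] first, then [J]. *)
pose l := enum (~: J)%SET ++ enum J.
have sC : size (enum (~: J)%SET) = (r - q)%N by rewrite -cardE cardsCs finset.setCK card_ord Jq.
have sl : size l = r by rewrite size_cat sC -cardE Jq subnK.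
have ul : uniq l.
  rewrite cat_uniq !enum_uniq andbT/=; apply/hasPn => k.
  by rewrite !mem_enum inE => ->.
have inj : injective (fun k : 'I_r => nth k0 l k).
  move=> a b /eqP; rewrite nth_uniq ?sl// => /eqP; exact: val_inj.
pose c (k : nat) (a : 'I_d) : R := if (k < r - q)%N then x (nth k0 l k) 0 a else 1.
rewrite (sum_tensor_perm (perm inj) (fun k a => if k \in J then 1 else x k 0 a))//.
have -> : \sum_i A i * \prod_k
     (if perm inj k \in J then 1 else x (perm inj k) 0 (tnth i k)) =
   \sum_i A i * \prod_(k < r) c k (tnth i k).
  apply: eq_bigr => i _; congr (_ * _); apply: eq_bigr => k _.
  rewrite permE /c /l nth_cat sC; case: ltnP => kq.
    have : nth k0 (enum (~: J)%SET) k \in enum (~: J)%SET by rewrite mem_nth// sC.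
    by rewrite mem_enum inE => /negbTE ->.
  have : nth k0 (enum J) (k - (r - q)) \in enum J.
    by rewrite mem_nth// -cardE Jq ltn_subLR// subnK.
  by rewrite mem_enum => ->.
rewrite (sum_tensor_ignore_tail (subnK hq)); last first.
  by move=> k a; rewrite /c ltnNge => ->.
apply: le_trans (rank1_pairing_le_injnorm p0 (contract1 hq A) _); last first.
  by move=> k; exact: (xp (nth k0 l k)).
rewrite le_eqVlt; apply/orP; left; apply/eqP; apply: eq_bigr => j _.
rewrite ffunE; congr (_ * _); apply: eq_bigr => k _.
by rewrite /c ltn_ord.
Qed.

(** Expand the product over the sets [J] of positions where t is chosen. Each of the 2^r terms is
    t^|J| times a contraction, and the hypotheses bound all of them by t m. *)
Lemma sum_tensor_shifted_le (x : 'I_r -> 'rV[R]_d) (t m : R) :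
  0 < t -> (forall k, lnorm p (x k) <= 1) ->
  injnorm p A <= t * m ->
  (forall q (hq : (q <= r)%N), (0 < q)%N ->
     t ^+ q * injnorm p (contract1 hq A) <= t * m) ->
  \sum_i A i * \prod_k (x k 0 (tnth i k) + t) <= (2 ^ r)%:R * (t * m).
Proof.
move=> t0 xp h0 hq.
have E i : \prod_k (x k 0 (tnth i k) + t) = \sum_(J : {set 'I_r})
    t ^+ #|J| * \prod_k (if k \in J then 1 else x k 0 (tnth i k)).
  under eq_bigr do rewrite addrC.
  rewrite bigA_distr; apply: eq_bigr => J _.
  rewrite -prodr_const [X in X * _]big_mkcond -big_split/=.
  by apply: eq_bigr => k _; case: ifP; rewrite ?mulr1 ?mul1r.
under eq_bigr do rewrite E mulr_sumr.
rewrite exchange_big/=.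
have -> : (2 ^ r)%:R * (t * m) = \sum_(J : {set 'I_r}) (t * m).
  by rewrite sumr_const mulr_natl -cardsT -powersetT card_powerset cardsT card_ord.
apply: ler_sum => J _.
under eq_bigr do rewrite mulrCA.
rewrite -mulr_sumr.
have hJ : (#|J| <= r)%N by rewrite -[r in (_ <= r)%N]card_ord max_card.
have [J0|J0] := posnP #|J|; last first.
  apply: le_trans (hq _ hJ J0); apply: ler_wpM2l; first by rewrite exprn_ge0// ltW.
  exact: sum_tensor_subset_le.
rewrite J0 expr0 mul1r; apply: le_trans h0.
apply: le_trans (rank1_pairing_le_injnorm p0 A xp).
rewrite le_eqVlt; apply/orP; left; apply/eqP; apply: eq_bigr => i _.
congr (_ * _); apply: eq_bigr => k _.
by move/cards0_eq: J0 => ->; rewrite inE.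
Qed.

End Contraction.

(** * Tensors in dimension one *)

Section DimensionOne.
Variables (R : realType) (r : nat) (p : R) (A : tensor R 1 r).
Hypotheses (p0 : 0 < p).

Lemma tuple_ord1 m (i j : m.-tuple 'I_1) : i = j.
Proof. by apply: eq_from_tnth => k; rewrite !ord1. Qed.

Lemma sum_tuple_ord1 m (F : m.-tuple 'I_1 -> R) i : \sum_j F j = F i.
Proof. by rewrite (bigD1 i)//= big1 ?addr0// => j /eqP[]; exact: tuple_ord1. Qed.

Lemma contract1_ord1 q (hq : (q <= r)%N) i j : contract1 hq A i = A j.
Proof.
rewrite ffunE (sum_tuple_ord1 _ [tuple ord0 | _ < q]).
by congr (A _); exact: tuple_ord1.
Qed.

Lemma le_injnorm_ord1 m (S : tensor R 1 m) i : S i <= injnorm p S.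
Proof.
have := @rank1_pairing_le_injnorm R 1 p p0 m S (fun _ => \row_ _ 1).
rewrite /rank1_pairing (sum_tuple_ord1 _ i) big1 ?mulr1.
  apply=> _; rewrite lnorm_le1// big_ord_recl big_ord0 addr0 mxE normr1.
  by rewrite powR1.
by move=> k _; rewrite mxE.
Qed.

Lemma injnorm_ord1_le m (S : tensor R 1 m) i : (0 < m)%N -> injnorm p S <= `|S i|.
Proof.
move=> m0; apply: injnorm_le => // x xp.
rewrite /rank1_pairing (sum_tuple_ord1 _ i).
apply: (le_trans (ler_norm _)); rewrite normrM ler_piMr// normr_prod.
by apply: prodr_ile1 => k _; rewrite normr_ge0/=; exact: lnorm_entry (xp k).
Qed.

End DimensionOne.

(** * Expectation of the injective norm *)

(* No measurability of [f] is assumed: the integral of a nonnegative function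
   is a supremum over the simple functions below it. *)
Lemma ge0_le_integral_nonmeasurable d (T : measurableType d) (R : realType)
    (mu : {measure set T -> \bar R}) (f g : T -> \bar R) :
  (forall x, 0 <= f x)%E -> (forall x, f x <= g x)%E ->
  (\int[mu]_x f x <= \int[mu]_x g x)%E.
Proof.
move=> f0 fg; rewrite !ge0_integralTE//; last first.
  by move=> x; exact: le_trans (fg x).
apply: le_ereal_sup => _ [h hf <-]; exists h => // x.
exact: le_trans (hf x) (fg x).
Qed.

Section TensorRounding.
Variables (R : realType) (r d N : nat) (s : R).
Hypotheses (N0 : (0 < N)%N) (s0 : 0 < s).

Definition rank1_grid (u : {ffun 'I_r -> grid d N}) (i : r.-tuple 'I_d) : R :=
  \prod_(k < r) grid_point s (u k) (tnth i k).

(** The mass of each point under the uniform law, which is the rounding of x = 0 and the reference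
    measure for the entropy. *)
Definition grid_mass : R := (2^-1 ^+ (d * N)) ^+ r.

Lemma grid_mass_ge0 : 0 <= grid_mass.
Proof. by rewrite !exprn_ge0// invr_ge0. Qed.

Lemma sum_grid_mass : \sum_(u : {ffun 'I_r -> grid d N}) grid_mass = 1.
Proof.
rewrite sumr_const card_ffun card_ffun card_prod card_bool !card_ord.
rewrite -mulr_natl /grid_mass !natrX -exprMn -exprMn mulfV ?expr1n//.
Qed.

Section Point.
Variable x : 'I_r -> 'I_d -> R.
Hypothesis xN : forall k j, `|x k j| <= N%:R * s.

Let W := prod_weight (fun k => rounding (N:=N) s (x k)).

Lemma sum_rank1_grid i : \sum_u W u * rank1_grid u i = \prod_k x k (tnth i k).
Proof.
rewrite (sum_prod_weight_prod _ (fun k e => grid_point s e (tnth i k))).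
by apply: eq_bigr => k _; rewrite rounding_mean.
Qed.

Lemma sum_rank1_grid_sqr i :
  \sum_u W u * rank1_grid u i ^+ 2
  <= \prod_k (x k (tnth i k) ^+ 2 + N%:R * s ^+ 2).
Proof.
under [leLHS]eq_bigr do rewrite /rank1_grid -prodrXl.
rewrite (sum_prod_weight_prod _ (fun k e => grid_point s e (tnth i k) ^+ 2)).
apply: ler_prod => k _; rewrite rounding_sqr// andbT.
by apply: sumr_ge0 => e _; rewrite mulr_ge0 ?sqr_ge0 ?rounding_ge0.
Qed.

(** The variational inequality for the exponent l <T, y> - b sum_i A_i y_i^2: its linear part has an
    exact mean under the rounding, its quadratic part a bounded one. The exponential sum on the
    right does not depend on x. *)
Lemma pairing_variational (T A : r.-tuple 'I_d -> R) (l b : R) :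
  (forall i, 0 <= A i) -> 0 <= b ->
  l * (\sum_i T i * \prod_k x k (tnth i k))
   - b * \sum_i A i * \prod_k (x k (tnth i k) ^+ 2 + N%:R * s ^+ 2)
  <= \sum_u grid_mass * expR (l * (\sum_i T i * rank1_grid u i)
       - b * \sum_i A i * rank1_grid u i ^+ 2) - 1
     + \sum_k \sum_j x k j ^+ 2 / (N%:R * s ^+ 2).
Proof.
move=> A0 b0.
have h2 : 0 <= 2^-1 ^+ (d * N) :> R by rewrite exprn_ge0.
have := entropy_le_prod h2 (fun k => entropy_le_rounding N0 s0 (xN k)).
rewrite card_ord => H; apply: le_trans (entropy_le_variational _ H).
have W0 u : 0 <= W u by case: H.
rewrite -/W; under [leRHS]eq_bigr do rewrite mulrBr.
rewrite sumrB; apply: lerB.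
  rewrite le_eqVlt; apply/orP; left; apply/eqP.
  under [RHS]eq_bigr do rewrite mulrCA mulr_sumr.
  rewrite -mulr_sumr exchange_big/=; congr (_ * _); apply: eq_bigr => i _.
  rewrite -sum_rank1_grid mulr_sumr; apply: eq_bigr => u _.
  by rewrite mulrCA.
under eq_bigr do rewrite mulrCA mulr_sumr.
rewrite -mulr_sumr exchange_big/= ler_wpM2l//; apply: ler_sum => i _.
under eq_bigr do rewrite mulrCA.
by rewrite -mulr_sumr ler_wpM2l// sum_rank1_grid_sqr.
Qed.

End Point.
End TensorRounding.

Section InjnormExpectation.
Context disp (Omega : measurableType disp) (R : realType)
  (P : probability Omega R) (d r : nat) (T : r.-tuple 'I_d -> {RV P >-> R}).
Hypothesis Tsym : forall w : Omega, symmetric_tensor (realization T w).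
Hypothesis Tgauss : jointly_gaussian T.
Hypothesis Tmean : forall i, ('E_P[T i] = 0)%E.
Hypothesis Tindep : mutually_independent (@nondecreasing_index d r) T.
Hypothesis r0 : (0 < r)%N.
Variables (p D t V l : R).
Hypotheses (p0 : 0 < p) (t0 : 0 < t) (l0 : 0 < l).
Hypothesis ball_entry : forall x : 'rV[R]_d, lnorm p x <= 1 -> forall j, `|x 0 j| <= 1.
Hypothesis ball_l2 : forall x : 'rV[R]_d, lnorm p x <= 1 -> \sum_j x 0 j ^+ 2 <= D.
Hypothesis ball_variance : forall x : 'I_r -> 'rV[R]_d,
  (forall k, lnorm p (x k) <= 1) ->
  \sum_i variance_tensor T i * \prod_k (x k 0 (tnth i k) ^+ 2 + t ^+ 2) <= V.

Let A := variance_tensor T.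

Lemma expectation_injnorm_le :
  ('E_P[fun w => injnorm p (realization T w)]
   <= (r%:R * D / (t ^+ 2 * l) + l * r`!%:R * V / 2)%:E)%E.
Proof.
(* With step s = t / sqrt N the rounding variance bound N s^2 is t^2, and N >= 1 / t^2 makes the
   grid reach N s >= 1, hence all entries of the unit ball. *)
have [N [N0 tN]] : exists N : nat, (0 < N)%N /\ 1 <= N%:R * t ^+ 2.
  have i0 : 0 < (t ^+ 2)^-1 by rewrite invr_gt0 exprn_gt0.
  have iN := archi_boundP (ltW i0).
  exists (Num.bound (t ^+ 2)^-1); split; first by rewrite -(ltr0n R) (lt_trans i0 iN).
  by rewrite -ler_pdivrMr ?exprn_gt0// mul1r ltW.
have Nr : 0 < N%:R :> R by rewrite ltr0n.
pose s := t / Num.sqrt N%:R.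
have s0 : 0 < s by rewrite divr_gt0// sqrtr_gt0.
have Ns2 : N%:R * s ^+ 2 = t ^+ 2.
  by rewrite /s exprMn exprVn sqr_sqrtr ?ltW// mulrCA mulfV ?gt_eqF// mulr1.
have Ns1 : 1 <= N%:R * s.
  have Ns0 : 0 <= N%:R * s by rewrite mulr_ge0// ltW.
  rewrite -(@ler_pXn2r _ 2%N)// ?nnegrE//. 
  by rewrite expr1n exprMn (expr2 N%:R) -mulrA Ns2.
(* With this b the quadratic term compensates the subgaussian bound for l <T, y>, so each
   exponential has mean at most 1. *)
pose b := r`!%:R * l ^+ 2 / 2.
have b0 : 0 <= b by rewrite divr_ge0// mulr_ge0 ?sqr_ge0.
have A0 i : 0 <= A i by exact: variance_tensor_ge0.
pose c (u : {ffun 'I_r -> grid d N}) := rank1_grid s u.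
pose F u w := l * (\sum_i T i w * c u i) - b * \sum_i A i * c u i ^+ 2.
pose Z w := \sum_u grid_mass R r d N * expR (F u w).
have mF u : measurable_fun setT (F u).
  apply: measurable_funB => //; apply: measurable_funM => //.
  by apply: measurable_sum => i; exact: measurable_funM.
have mE u : measurable_fun setT (fun w => grid_mass R r d N * expR (F u w)).
  by apply: measurable_funM => //; exact: measurableT_comp.
have mZ : measurable_fun setT Z by exact: measurable_sum.
have Z0 w : 0 <= Z w.
  by apply: sumr_ge0 => u _; rewrite mulr_ge0 ?expR_ge0 ?grid_mass_ge0.
have EF u : (\int[P]_w (expR (F u w))%:E <= 1)%E.
  have := pairing_subgaussian Tsym Tgauss Tmean Tindep (fun i => l * c u i).
  rewrite -/A; set v := r`!%:R * _ / 2 => H.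
  have vE : v = b * \sum_i A i * c u i ^+ 2.
    rewrite /v /b (_ : \sum_i A i * (l * c u i) ^+ 2 =
       l ^+ 2 * \sum_i A i * c u i ^+ 2); first by ring.
    by rewrite mulr_sumr; apply: eq_bigr => i _; ring.
  rewrite (_ : (fun w => _) = (fun w => (expR (- v))%:E *
     (expR (\sum_i l * c u i * T i w))%:E)%E); last first.
    apply/funext => w; rewrite -EFinM -expRD /F -vE [in RHS]addrC; congr (expR (_ - _))%:E.
    by rewrite mulr_sumr; apply: eq_bigr => i _; ring.
  rewrite ge0_integralZl_EFin ?expR_ge0//; last first.
    by apply/measurable_EFinP; apply: measurableT_comp => //; exact: measurable_pairing.
  apply: (le_trans (lee_wpmul2l _ H)); first by rewrite lee_fin expR_ge0.
  by rewrite -EFinM -expRD addNr expR0.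
have EZ : (\int[P]_w (Z w)%:E <= 1)%E.
  under eq_integral do rewrite -sumEFin.
  rewrite ge0_integral_sum//; last 2 first.
  - by move=> u; exact/measurable_EFinP.
  - by move=> u w _; rewrite lee_fin mulr_ge0 ?expR_ge0 ?grid_mass_ge0.
  rewrite -(sum_grid_mass R r d N) -sumEFin; apply: lee_sum => u _.
  under eq_integral do rewrite EFinM.
  rewrite ge0_integralZl_EFin ?grid_mass_ge0//; last first.
    by apply/measurable_EFinP; exact: measurableT_comp.
  rewrite -[leRHS]mule1; apply: lee_wpmul2l; last exact: EF.
  by rewrite lee_fin grid_mass_ge0.
pose C0 := - 1 + r%:R * D / t ^+ 2 + b * V.
(* A pathwise bound uniform over the ball: the supremum is controlled by the finite sum [Z], whose
   mean is at most 1. *)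
have bound w : injnorm p (realization T w) <= l^-1 * Z w + l^-1 * C0.
  rewrite -mulrDr; apply: injnorm_le => // x xp; rewrite ler_pdivlMl//.
  have xN k j : `|x k 0 j| <= N%:R * s.
    exact: le_trans (ball_entry (xp k) j) Ns1.
  have := pairing_variational N0 s0 xN (fun i => T i w) l A0 b0.
  rewrite Ns2 -/c -/(F _ w).
  have -> : rank1_pairing (realization T w) x =
      \sum_i T i w * \prod_k x k 0 (tnth i k).
    by apply: eq_bigr => i _; rewrite ffunE.
  have h1 := ler_wpM2l b0 (ball_variance xp).
  have h2 : \sum_(k < r) \sum_j x k 0 j ^+ 2 / t ^+ 2 <= r%:R * D / t ^+ 2.
    under eq_bigr do rewrite -mulr_suml.
    rewrite -mulr_suml ler_wpM2r ?invr_ge0 ?sqr_ge0//.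
    rewrite -[r in r%:R * D]card_ord mulr_natl -sumr_const.
    by apply: ler_sum => k _; exact: ball_l2.
  rewrite /C0 /Z; lra.
rewrite unlock.
apply: (@le_trans _ _ (\int[P]_w ((l^-1)%:E * (Z w)%:E + (l^-1 * C0)%:E))%E).
  apply: ge0_le_integral_nonmeasurable => w.
    by rewrite lee_fin injnorm_ge0.
  by rewrite -EFinM -EFinD lee_fin.
have iZ : P.-integrable setT (EFin \o Z).
  apply/integrableP; split; first exact/measurable_EFinP.
  under eq_integral do rewrite /= ger0_norm//.
  by apply: le_lt_trans EZ _; rewrite ltry.
rewrite integralD//; last 2 first.
- exact: integrableZl.
- exact: finite_measure_integrable_cst.
have -> : (\int[P]_w (l^-1 * C0)%:E = (l^-1 * C0)%:E)%E.
  by have := expectation_cst P (l^-1 * C0); rewrite unlock.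
rewrite integralZl//.
apply: (@le_trans _ _ ((l^-1)%:E * 1 + (l^-1 * C0)%:E)%E).
  by rewrite leeD2r// lee_wpmul2l// lee_fin invr_ge0 ltW.
rewrite mule1 -EFinD lee_fin /C0 /b le_eqVlt; apply/orP; left; apply/eqP.
by field; rewrite !gt_eqF.
Qed.

End InjnormExpectation.

(** * Choice of the scale and conclusion *)

Lemma scale_exists (R : realType) (r : nat) (a M : R) (b : 'I_r.+1 -> R) :
  0 <= a -> 0 < M -> (forall q, 0 <= b q) ->
  (forall q : 'I_r.+1, (2 <= q)%N ->
     b q `^ (2 * q%:R)^-1 * a `^ ((q%:R - 1) / (2 * q%:R)) <= M) ->
  exists2 t, 0 < t & a <= t * M ^+ 2 /\
    forall q : 'I_r.+1, (2 <= q)%N -> t ^+ q * b q <= t * M ^+ 2.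
Proof.
move=> a0 M0 b0 bM; have M2 : 0 < M ^+ 2 by rewrite exprn_gt0.
(* For a = 0 the value a / M^2 is not positive; any small t <= 1 serves instead, as t^q <= t^2 for q
   >= 2. *)
have [a_eq0|an0] := eqVneq a 0.
  pose S := \sum_q b q.
  have S0 : 0 < S + 1 by rewrite ltr_wpDl// sumr_ge0.
  pose t := Num.min 1 (M ^+ 2 / (S + 1)).
  have t0 : 0 < t by rewrite lt_min ltr01 divr_gt0.
  have t1 : t <= 1 by rewrite ge_min lexx.
  have tS : t * (S + 1) <= M ^+ 2 by rewrite -ler_pdivlMr// ge_min lexx orbT.
  exists t => //; split; first by rewrite a_eq0 mulr_ge0// ltW.
  move=> q q2.
  have bS : b q <= S + 1.
    rewrite /S (bigD1 q)//= -addrA lerDl addr_ge0// sumr_ge0//.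
  apply: (@le_trans _ _ (t ^+ 2 * b q)).
    by rewrite ler_wpM2r// ler_wiXn2l// ltW.
  rewrite expr2 -mulrA ler_pM2l//; apply: le_trans tS.
  by rewrite ler_pM2l.
have a_gt0 : 0 < a by rewrite lt_neqAle eq_sym an0.
(* This t gives equality in the condition on a. The condition at q becomes b_q a^(q-1) <= M^(2q),
   the 2q-th power of the hypothesis. *)
exists (a / M ^+ 2); first by rewrite divr_gt0.
split; first by rewrite divfK// gt_eqF.
move=> q q2; have /prednK qE : (0 < q)%N by apply: leq_trans q2.
have q0 : 0 < q%:R :> R by rewrite ltr0n -qE.
have H : b q * a ^+ q.-1 <= M ^+ (2 * q)%N.
  have q20 : (0 < 2 * q)%N by rewrite muln_gt0 -qE.
  have eb : (b q `^ (2 * q%:R)^-1) ^+ (2 * q) = b q.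
    rewrite -powR_mulrn ?powR_ge0// -powRrM natrM mulVf ?powRr1//.
    by rewrite mulf_neq0 ?gt_eqF.
  have ea : (a `^ ((q%:R - 1) / (2 * q%:R))) ^+ (2 * q) = a ^+ q.-1.
    rewrite -powR_mulrn ?powR_ge0// -powRrM natrM divfK ?mulf_neq0 ?gt_eqF//.
    by rewrite -powR_mulrn// -{1}qE -natr1 addrK.
  rewrite -{1}eb -ea -exprMn ler_pXn2r ?nnegrE ?mulr_ge0 ?powR_ge0//.
    exact: bM.
  exact: ltW.
rewrite -{1}qE exprS -mulrA ler_pM2l ?divr_gt0//.
rewrite exprMn exprVn mulrAC ler_pdivrMr ?exprn_gt0// mulrC -exprS qE -exprM.
exact: H.
Qed.

Section ExpectationBound.
Context disp (Omega : measurableType disp) (R : realType)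
  (P : probability Omega R) (d r : nat) (T : r.-tuple 'I_d -> {RV P >-> R}).
Hypothesis Tsym : forall w : Omega, symmetric_tensor (realization T w).
Hypothesis Tgauss : jointly_gaussian T.
Hypothesis Tmean : forall i, ('E_P[T i] = 0)%E.
Hypothesis Tindep : mutually_independent (@nondecreasing_index d r) T.
Hypotheses (d0 : (0 < d)%N) (r0 : (0 < r)%N).
Variable p : R.
Hypothesis p2 : 2 <= p.

Let A := variance_tensor T.
Let p0 : 0 < p. Proof. exact: lt_le_trans p2. Qed.

Lemma variance_tensor_sym : symmetric_tensor A.
Proof.
move=> s i; rewrite !variance_tensorE; congr (Rintegral _ _ _).
by apply/funext => w; have := Tsym w s i; rewrite !ffunE => ->.
Qed.

(** Here [t] is the bound on the rounding variance, so the expectation bound is used at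
    [Num.sqrt t]. *)
Lemma expectation_injnorm_scale (t B : R) : 0 < t -> 0 < B ->
  injnorm (p / 2) A <= t * B ^+ 2 ->
  (forall q (hq : (q <= r)%N), (0 < q)%N ->
     t ^+ q * injnorm (p / 2) (contract1 hq A) <= t * B ^+ 2) ->
  ((d%:R `^ (p^-1 - 2^-1))%:E * 'E_P[fun w => injnorm p (realization T w)]
   <= ((r%:R + r`!%:R * (2 ^ r)%:R) * B)%:E)%E.
Proof.
move=> t0 B0 h0 hq.
have dR : 0 < d%:R :> R by rewrite ltr0n.
set K := d%:R `^ (p^-1 - 2^-1); have K0 : 0 < K by exact: powR_gt0.
pose D := d%:R `^ (1 - 2 / p).
have KD : D = K^-1 ^+ 2.
  rewrite /K -powRN -powR_mulrn ?powR_ge0// -powRrM; congr (_ `^ _).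
  by field; rewrite gt_eqF.
(* This l balances the two terms: after multiplication by K the entropy gives r B and the variance
   r! 2^r B / 2. *)
pose l := K^-1 / (t * B).
have l0 : 0 < l by rewrite divr_gt0 ?invr_gt0// mulr_gt0.
have st2 : Num.sqrt t ^+ 2 = t by rewrite sqr_sqrtr// ltW.
have st0 : 0 < Num.sqrt t by rewrite sqrtr_gt0.
have bV (x : 'I_r -> 'rV[R]_d) : (forall k, lnorm p (x k) <= 1) ->
    \sum_i A i * \prod_k (x k 0 (tnth i k) ^+ 2 + Num.sqrt t ^+ 2)
    <= (2 ^ r)%:R * (t * B ^+ 2).
  move=> xp; rewrite st2.
  have p20 : 0 < p / 2 by rewrite divr_gt0.
  have := sum_tensor_shifted_le p20 r0 variance_tensor_sym t0
    (fun k => lnorm_sqr p0 (xp k)) h0 hq.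
  by under eq_bigr do under eq_bigr do rewrite mxE.
have := expectation_injnorm_le Tsym Tgauss Tmean Tindep r0 p0 st0 l0
  (fun x xp j => lnorm_entry j p0 xp)
  (fun x xp => lnorm_sum_sqr p2 d0 xp) bV.
rewrite -/D st2 => H; apply: (le_trans (lee_wpmul2l _ H)).
  by rewrite lee_fin ltW.
rewrite -EFinM lee_fin KD /l.
have -> : K * (r%:R * K^-1 ^+ 2 / (t * (K^-1 / (t * B))) +
   K^-1 / (t * B) * r`!%:R * ((2 ^ r)%:R * (t * B ^+ 2)) / 2) =
   (r%:R + r`!%:R * (2 ^ r)%:R / 2) * B.
  by field; rewrite !gt_eqF.
rewrite ler_pM2r// lerD2l ler_pdivrMr// ler_peMr ?mulr_ge0//.
by rewrite ler1n.
Qed.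

Lemma expectation_injnorm_bound (W M : R) : 0 <= W -> 0 <= M ->
  (forall hq : (1 <= r)%N, injnorm (p / 2) (contract1 hq A) <= (W + M) ^+ 2) ->
  (forall q : 'I_r.+1, (2 <= q)%N ->
     injnorm (p / 2) (contract1 (leq_ord q) A) `^ (2 * q%:R)^-1
     * injnorm (p / 2) A `^ ((q%:R - 1) / (2 * q%:R)) <= M) ->
  ((d%:R `^ (p^-1 - 2^-1))%:E * 'E_P[fun w => injnorm p (realization T w)]
   <= ((r%:R + r`!%:R * (2 ^ r)%:R) * (W + M))%:E)%E.
Proof.
move=> W0 M0 h1 hM; set C := r%:R + _.
have C0 : 0 < C.
  by rewrite ltr_wpDr ?ltr0n// mulr_ge0.
(* A positive bound is required to choose the scale, while W + M may vanish; hence the slack e /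
   C. *)
apply/lee_addgt0Pr => e e0; rewrite -EFinD.
have -> : C * (W + M) + e = C * (W + M + e / C) by field; rewrite gt_eqF.
have eC : 0 < e / C by rewrite divr_gt0.
have p20 : 0 < p / 2 by rewrite divr_gt0.
have B0 : 0 < W + M + e / C by rewrite ltr_wpDl// addr_ge0.
have [|q|q q2|t t0 [ht hq]] := @scale_exists R r (injnorm (p / 2) A) (W + M + e / C)
  (fun q => injnorm (p / 2) (contract1 (leq_ord q) A)) _ B0.
- exact: injnorm_ge0.
- exact: injnorm_ge0.
- by apply: le_trans (hM q q2) _; rewrite -addrA addrCA lerDl addr_ge0// ltW.
apply: (expectation_injnorm_scale t0 B0 ht) => q hqr q_gt0.
(* At q = 1 the factor t cancels, so this condition holds at every scale; q >= 2 is what the scale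
   was chosen for. *)
have [q1|q1] := leqP q 1.
  have qE : q = 1%N by apply/eqP; rewrite eqn_leq q1.
  subst q; rewrite expr1 ler_pM2l//; apply: (le_trans (h1 _)).
  rewrite ler_pXn2r ?nnegrE ?addr_ge0// ?lerDl; exact: ltW.
pose q' : 'I_r.+1 := Ordinal (hqr : (q < r.+1)%N).
by have := hq q' q1; rewrite (bool_irrelevance hqr (leq_ord q')).
Qed.

End ExpectationBound.

Theorem theorem2p1 (R : realType) (r : nat) (hr : (2 <= r)%N)
    (p : R) (hp : 2 <= p) :
  exists C : R, 0 < C /\
    forall (d : nat) (hd : (1 <= d)%N)
      (disp : measure_display) (Omega : measurableType disp)
      (P : probability Omega R) (T : r.-tuple 'I_d -> {RV P >-> R}),
    (forall w : Omega, symmetric_tensor (realization T w)) ->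
    jointly_gaussian T ->
    (forall i : r.-tuple 'I_d, ('E_P[T i] = 0)%E) ->
    mutually_independent (@nondecreasing_index d r) T ->
    let A := variance_tensor T in
    ((d%:R `^ (p^-1 - 2^-1))%:E
       * 'E_P[fun w => injnorm p (realization T w)]
     <= (C * (ln d%:R
                * injnorm (p / 2) (contract1 (ltnW hr : (1 <= r)%N) A) `^ 2^-1
              + \big[Num.max/0]_(q < r.+1 | (2 <= q)%N)
                  (injnorm (p / 2) (contract1 (leq_ord q) A)
                     `^ (2 * q%:R)^-1
                   * injnorm (p / 2) A
                       `^ ((q%:R - 1) / (2 * q%:R)))))%:E)%E.
Proof.
have ln2 : 0 < ln 2 :> R by rewrite ln_gt0// ltr1n.
pose C : R := r%:R + r`!%:R * (2 ^ r)%:R.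
have r0 : (0 < r)%N by exact: ltnW.
have C0 : 0 < C by rewrite ltr_wpDr ?ltr0n// mulr_ge0.
(* The summand (ln 2)^-1 pays for the logarithm: W <= (ln 2)^-1 (ln d) W when d >= 2. *)
exists (C * (1 + (ln 2)^-1)).
have C1 : 0 < C * (1 + (ln 2)^-1).
  by rewrite mulr_gt0// addr_gt0// invr_gt0.
split=> [//|].
move=> d hd disp Omega P T Tsym Tgauss Tmean Tindep.
cbv zeta; set A := variance_tensor T.
have p20 : 0 < p / 2 by rewrite divr_gt0//; lra.
set W := injnorm (p / 2) (contract1 _ A) `^ 2^-1.
set M := \big[Num.max/0]_(q < r.+1 | _) _.
have W0 : 0 <= W by exact: powR_ge0.
have M0 : 0 <= M by rewrite /M; exact: bigmax_ge_id.
have hM (q : 'I_r.+1) : (2 <= q)%N ->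
     injnorm (p / 2) (contract1 (leq_ord q) A) `^ (2 * q%:R)^-1
     * injnorm (p / 2) A `^ ((q%:R - 1) / (2 * q%:R)) <= M.
  by move=> q2; exact: (le_bigmax_cond 0 (fun q : 'I_r.+1 => _) q2).
have WE (hq : (1 <= r)%N) : injnorm (p / 2) (contract1 hq A) = W ^+ 2.
  rewrite (bool_irrelevance hq (ltnW hr)) /W -powR_mulrn ?powR_ge0// -powRrM.
  by rewrite mulVf// powRr1// injnorm_ge0.
have bound := expectation_injnorm_bound Tsym Tgauss Tmean Tindep hd r0 hp.
(* In dimension one the logarithm vanishes, but then [W ^+ 2 <= M ^+ 2]. *)
have [d1|d2] := leqP d 1.
  have {d1} dE : d = 1%N by apply/eqP; rewrite eqn_leq d1.
  subst d; rewrite ln1 mul0r add0r.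
  have WM : W ^+ 2 <= M ^+ 2.
    pose i0 : r.-tuple 'I_1 := [tuple ord0 | _ < r].
    pose j0 m : m.-tuple 'I_1 := [tuple ord0 | _ < m].
    have A0 : 0 <= A i0 by exact: variance_tensor_ge0.
    (* The term q = 2 has both exponents equal to 1/4, so the single entry of A satisfies A^(1/2) <=
       M. *)
    have q2 : (2 < r.+1)%N by [].
    have h2 := hM (Ordinal q2) isT.
    have : A i0 <= M ^+ 2.
      pose e : R := (2 * 2)^-1.
      have e0 : 0 <= e by rewrite invr_ge0 mulr_ge0.
      have yM : A i0 `^ e * A i0 `^ e <= M.
        apply: le_trans h2; rewrite (_ : (_ - 1) / _ = e); last first.
          by rewrite /e/=; field.
        apply: ler_pM; rewrite ?powR_ge0//; apply: ge0_ler_powR;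
          rewrite ?nnegrE ?injnorm_ge0//; last exact: le_injnorm_ord1.
        by rewrite -(contract1_ord1 A (leq_ord (Ordinal q2)) (j0 _) i0) le_injnorm_ord1.
      have -> : A i0 = (A i0 `^ e * A i0 `^ e) ^+ 2.
        rewrite exprMn -exprD -powR_mulrn ?powR_ge0// -powRrM.
        by rewrite (_ : e * _ = 1) ?powRr1// /e; field.
      by rewrite ler_pXn2r ?nnegrE ?mulr_ge0 ?powR_ge0.
    apply: le_trans; rewrite -(WE r0).
    apply: (le_trans (injnorm_ord1_le p20 _ (j0 _) _)); first by rewrite subn_gt0.
    by rewrite (contract1_ord1 A _ _ i0) ger0_norm.
  (* The maximum alone controls the contraction q = 1, so the bound applies with 0 in place of W. *)
  apply: (le_trans (bound 0 M _ M0 _ hM)) => //.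
    by move=> hq; rewrite WE add0r.
  rewrite lee_fin add0r -mulrA ler_pM2l// ler_peMl// lerDl invr_ge0 ltW//.
apply: (le_trans (bound W M W0 M0 _ hM)).
  by move=> hq; rewrite WE ler_pXn2r ?nnegrE ?addr_ge0// lerDl.
rewrite lee_fin -mulrA ler_pM2l//.
have lnd : ln 2 <= ln d%:R :> R by rewrite ler_ln ?posrE ?ltr0n// ler_nat.
have h1 : W <= (ln 2)^-1 * (ln d%:R * W).
  by rewrite mulrA ler_peMl// mulrC ler_pdivlMr// mul1r.
have i2 : 0 <= (ln 2)^-1 :> R by rewrite invr_ge0 ltW.
have h2 := mulr_ge0 i2 M0.
have h3 : 0 <= ln d%:R * W by rewrite mulr_ge0// (le_trans (ltW ln2)).
lra.
Qed.
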